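(* Let $p$ be a prime and let $G$ be a finite group that contains a strongly $p$-embedded subgroup. Then there is an infinite family of $1$-dimensional slender synthetic buildings for $G$ at the prime $p$, all of distinct homotopy types.
   Context: A proper subgroup $S<G$ is strongly $p$-embedded in $G$ if $p$ divides $|S|$ and $p$ does not divide $|S\cap gSg^{-1}|$ whenever $g\in G$, $g\notin S$. A $G$-simplicial complex is a finite (possibly empty) simplicial complex $\Delta$ with a simplicial action of the finite group $G$ such that the setwise stabilizer of each simplex fixes that simplex pointwise. For $H\le G$, $\Delta^H$ denotes the fixed point subcomplex. Contractible spaces are non-empty. A $G$-simplicial complex $\Delta$ is a synthetic building for $G$ at the prime $p$ if (1) $\Delta^P$ is $N_G(P)$-equivariantly contractible for every non-identity $p$-subgroup $P\le G$, and (2) the stabilizer of every simplex has order divisible by $p$. $\Delta$ is slender if the orbit space $G\backslash\Delta$ is contractible. *)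

(* Defs.v *)
From HB Require Import structures.
From mathcomp Require Import all_boot all_order all_fingroup all_algebra.
From mathcomp Require Import generic_quotient pgroup.
From mathcomp Require Import all_classical reals topology normedtype.
Import Order.TTheory GRing.Theory Num.Theory.
Import numFieldNormedType.Exports.

Set Implicit Arguments.
Unset Strict Implicit.
Unset Printing Implicit Defensive.

Local Open Scope classical_set_scope.
Local Open Scope ring_scope.

Section Homotopy.
Variable R : realType.

(* The values of H outside X * [0, 1] are irrelevant. *)
Definition is_homotopy (X Y : topologicalType) (f g : X -> Y)
    (H : X * R -> Y) : Prop :=
  [/\ {within setT `*` `[0, 1], continuous H},
      forall x, H (x, 0) = f x & forall x, H (x, 1) = g x].

Definition homotopic (X Y : topologicalType) (f g : X -> Y) : Prop :=
  exists H : X * R -> Y, is_homotopy f g H.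

Definition homotopy_equivalent (X Y : topologicalType) : Prop :=
  exists (f : X -> Y) (g : Y -> X),
    [/\ continuous f, continuous g, homotopic (g \o f) id
      & homotopic (f \o g) id].

Definition contractible (X : topologicalType) : Prop :=
  exists x0 : X, homotopic id (fun _ : X => x0).

Definition equivariantly_contractible (X : topologicalType) (A : Type)
    (a : A -> X -> X) : Prop :=
  exists (x0 : X) (H : X * R -> X),
    [/\ is_homotopy id (fun _ => x0) H,
        forall g, a g x0 = x0
      & forall g x t, t \in `[0, 1] -> H (a g x, t) = a g (H (x, t))].

End Homotopy.

(* An element v of the ambient type is a vertex of the complex only if {v} is
   a simplex; so subcomplexes can share the ambient type.  Library actions act
   on the right: vact v g stands for g^-1 v. *)
Record GComplex (gT : finGroupType) (G : {group gT}) := MkGComplex {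
  ambient : finType;
  vact : action G ambient;
  simplices : {set {set ambient}};
  simplex_neq0 : forall s, s \in simplices -> s != finset.set0;
  simplex_face : forall s t : {set ambient},
    s \in simplices -> t \subset s -> t != finset.set0 -> t \in simplices;
  simplex_act : forall g s,
    g \in G -> s \in simplices -> (vact^*)%act s g \in simplices;
  simplex_stab : forall s,
    s \in simplices -> ('N_G(s | vact) \subset 'C_G(s | vact))%g }.

Arguments vact {gT G} _.
Arguments simplices {gT G} _.

Section Complexes.
Variables (gT : finGroupType) (G : {group gT}).

Definition has_dim (d : nat) (D : GComplex G) : Prop :=
  (exists2 s, s \in simplices D & #|s| = d.+1) /\
  (forall s, s \in simplices D -> (#|s| <= d.+1)%N).

Section FixedPoints.
Variables (D : GComplex G) (P : {group gT}).

Definition fixed_simplices : {set {set ambient D}} :=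
  finset.finset (fun s => (s \in simplices D) &&
                          (s \subset ('Fix_(vact D)(P))%g)).

Lemma fixed_simplex_neq0 s : s \in fixed_simplices -> s != finset.set0.
Proof. by rewrite inE => /andP[/simplex_neq0]. Qed.

Lemma fixed_simplex_face (s t : {set ambient D}) :
  s \in fixed_simplices -> t \subset s -> t != finset.set0 ->
  t \in fixed_simplices.
Proof.
rewrite !inE => /andP[sD sP] ts t0.
by rewrite (simplex_face sD ts t0) (fintype.subset_trans ts sP).
Qed.

Definition norm_act : action ('N_G(P))%g (ambient D) :=
  (vact D \ subsetIl G ('N(P))%g)%act.

Hypothesis sPG : P \subset G.

Lemma fixed_simplex_act g s : g \in ('N_G(P))%g -> s \in fixed_simplices ->
  (norm_act^*)%act s g \in fixed_simplices.
Proof.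
move=> gN; have /finset.setIP[gG _] := gN; rewrite !inE => /andP[sD sP].
apply/andP; split; first exact: (simplex_act gG sD).
have /fintype.subsetP/(_ g gN) := acts_subnorm_fix (vact D) P.
rewrite (finset.setIidPr sPG) => gfix; apply/fintype.subsetP => _ /imsetP[v vs ->].
by rewrite (astabs_act _ gfix) (fintype.subsetP sP).
Qed.

Lemma fixed_simplex_stab s : s \in fixed_simplices ->
  ('N_('N_G(P))(s | norm_act) \subset 'C_('N_G(P))(s | norm_act))%g.
Proof.
rewrite inE => /andP[sD _]; rewrite astabs_ract astab_ract.
apply/fintype.subsetP => g /finset.setIP[gN /finset.setIP[_ gs]].
have /finset.setIP[gG _] := gN.
have gC : g \in ('N_G(s | vact D))%g by apply/finset.setIP.
have /finset.setIP[_ {}gC] := fintype.subsetP (simplex_stab sD) g gC.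
by do 2?[apply/finset.setIP; split=> //].
Qed.

Definition fixed_complex : GComplex ('N_G(P)) :=
  MkGComplex fixed_simplex_neq0 fixed_simplex_face fixed_simplex_act
    fixed_simplex_stab.

End FixedPoints.

Section Realization.
Variables (R : realType) (D : GComplex G).

(* Points are given by their barycentric coordinates. *)
Definition realization_set : set {ptws ambient D -> R} :=
  [set x | [/\ forall v, 0 <= x v, \sum_v x v = 1
             & finset.finset (fun v => x v != 0) \in simplices D]].

Definition realization : topologicalType := realization_set.

Definition coord_act (g : subg_of G) (x : {ptws ambient D -> R}) :
    {ptws ambient D -> R} :=
  fun v => x (vact D v (sgval g)^-1%g).

Lemma coord_act_realization g x : realization_set x -> realization_set (coord_act g x).
Proof.
have gG := subgP g.
move=> [x0 x1 xD]; split=> [v||]; first exact: x0.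
  rewrite -x1 [RHS](reindex_inj (act_inj (vact D) (sgval g)^-1%g)).
  by apply: eq_bigr.
suff -> : finset.finset (fun v => coord_act g x v != 0) =
    (vact D)^*%act (finset.finset (fun v => x v != 0)) (sgval g).
  exact: simplex_act.
apply/finset.setP => v; rewrite inE; apply/idP/imsetP => [xv|[w + ->]].
  by exists (vact D v (sgval g)^-1%g); rewrite ?inE// actKVin.
by rewrite inE /coord_act actKin.
Qed.

Definition point_act (g : subg_of G) (x : realization) : realization :=
  exist _ (coord_act g (val x)) (mem_set (coord_act_realization g (set_valP x))).

Definition same_orbit (x y : realization) : bool := [exists g, point_act g x == y].

Lemma point_act1 x : point_act 1%g x = x.
Proof.
apply/val_inj/funext => v /=.
rewrite /coord_act (_ : sgval 1%g = 1%g)// invg1.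
by congr (val x _); rewrite (act1 (vact D)).
Qed.

Lemma point_actM g h x : point_act (g * h)%g x = point_act h (point_act g x).
Proof.
have gG := subgP g; have hG := subgP h.
apply/val_inj/funext => v; rewrite /= /coord_act.
change (val x (vact D v (sgval g * sgval h)^-1%g) =
  val x (vact D (vact D v (sgval h)^-1%g) (sgval g)^-1%g)).
by rewrite invMg actMin ?groupV.
Qed.

Lemma same_orbit_refl : reflexive same_orbit.
Proof. by move=> x; apply/existsP; exists 1%g; rewrite point_act1. Qed.

Lemma same_orbit_sym : symmetric same_orbit.
Proof.
suff sym x y : same_orbit x y -> same_orbit y x.
  by move=> x y; apply/idP/idP; exact: sym.
move=> /existsP[g /eqP <-]; apply/existsP; exists g^-1%g.
by rewrite -point_actM mulgV point_act1.
Qed.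

Lemma same_orbit_trans : transitive same_orbit.
Proof.
move=> y x z /existsP[g /eqP <-] /existsP[h /eqP <-].
by apply/existsP; exists (g * h)%g; rewrite point_actM.
Qed.

Definition orbit_rel : equiv_rel realization :=
  EquivRel same_orbit same_orbit_refl same_orbit_sym same_orbit_trans.

Definition orbit_space : topologicalType :=
  quotient_topology {eq_quot orbit_rel}%qT.

End Realization.

End Complexes.

Arguments point_act {gT G} R D g x.

Definition synthetic_building (R : realType) (gT : finGroupType)
    (G : {group gT}) (p : nat) (D : GComplex G) : Prop :=
  (forall (P : {group gT}) (sPG : P \subset G),
     (p.-group P)%g -> P :!=: 1%g ->
     equivariantly_contractible R (point_act R (fixed_complex D sPG))) /\
  (forall s, s \in simplices D -> (p %| #|('N_G(s | vact D))%g|)%N).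

Definition slender (R : realType) (gT : finGroupType) (G : {group gT})
    (D : GComplex G) : Prop :=
  contractible R (orbit_space R D).

Definition strongly_embedded (gT : finGroupType) (p : nat)
    (G S : {group gT}) : Prop :=
  [/\ S \proper G, (p %| #|S|)%N
    & forall g, g \in G -> g \notin S ->
        ~~ (p %| #|(S :&: S :^ g^-1)%g|)%N].

(* Main.v *)
Require Import Defs.
From mathcomp Require Import all_boot all_order all_fingroup all_algebra.
From mathcomp Require Import generic_quotient pgroup sylow complex ring lra.
From mathcomp Require Import all_classical reals topology normedtype realfun.
Import Order.TTheory GRing.Theory Num.Theory.
Import numFieldNormedType.Exports.

(* A nontrivial p-subgroup P fixes exactly one coset of the strongly
   p-embedded subgroup S.  Let D k be the complete bipartite graph joining the
   G-set of cosets of S to k + 1 points fixed by G.  All stabilizers contain a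
   conjugate of S, the fixed points of P form a star centered at the fixed
   coset, and the orbit space is the star of S; but D k itself has
   k (|G : S| - 1) independent cycles.

   To tell infinitely many of these graphs apart, consider continuous maps from
   the realization to the nonzero complex numbers, modulo squares.  On a compact
   space homotopic maps are congruent modulo squares, so these classes form a
   homotopy invariant.  Each D k has finitely many classes, yet at least k of
   them, so a fast-growing sequence of values of k gives distinct homotopy
   types. *)

Set Implicit Arguments.
Unset Strict Implicit.
Unset Printing Implicit Defensive.

Local Open Scope classical_set_scope.
Local Open Scope ring_scope.

(** * Nonvanishing complex functions modulo squares *)

Lemma continuous_scalerB (R : realType) (T : topologicalType) (a : R) (f g : T -> R) :
  continuous f -> continuous g -> continuous (fun x => a * f x - g x).
Proof.
move=> cf cg x; apply: cvgB; last exact: cg.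
by apply: cvgM; [exact: cvg_cst|exact: cf].
Qed.

Lemma continuous_pair (T U V : topologicalType) (f : T -> U) (g : T -> V) :
  continuous f -> continuous g -> continuous (fun x => (f x, g x)).
Proof. by move=> cf cg x; apply: (cvg_pair (cf x) (cg x)). Qed.

Section SquareClasses.
Variable R : realType.
Local Notation C := R[i].

Definition ccontinuous (T : topologicalType) (f : T -> C) : Prop :=
  continuous (fun x => complex.Re (f x)) /\ continuous (fun x => complex.Im (f x)).

Lemma ccontinuous_cst (T : topologicalType) (c : C) :
  ccontinuous (fun _ : T => c).
Proof. by split=> x; exact: cvg_cst. Qed.

Lemma ccontinuous_comp (T U : topologicalType) (h : T -> U) (f : U -> C) :
  continuous h -> ccontinuous f -> ccontinuous (f \o h).
Proof.
move=> ch [cr ci]; split=> x.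
  exact: (@continuous_comp _ _ _ h (fun y => complex.Re (f y)) x (ch x) (cr _)).
exact: (@continuous_comp _ _ _ h (fun y => complex.Im (f y)) x (ch x) (ci _)).
Qed.

Lemma ccontinuousM (T : topologicalType) (f g : T -> C) :
  ccontinuous f -> ccontinuous g -> ccontinuous (fun x => f x * g x).
Proof.
move=> [fr fi] [gr gi]; split=> x.
  rewrite (_ : (fun y => _) = fun y => complex.Re (f y) * complex.Re (g y) -
      complex.Im (f y) * complex.Im (g y)); last first.
    by apply/funext => y; case: (f y) (g y) => [? ?] [? ?].
  by apply: cvgB; apply: cvgM; [exact: fr|exact: gr|exact: fi|exact: gi].
rewrite (_ : (fun y => _) = fun y => complex.Re (f y) * complex.Im (g y) +
    complex.Im (f y) * complex.Re (g y)); last first.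
  by apply/funext => y; case: (f y) (g y) => [? ?] [? ?].
by apply: cvgD; apply: cvgM; [exact: fr|exact: gi|exact: fi|exact: gr].
Qed.

Lemma ccontinuousV (T : topologicalType) (f : T -> C) :
  (forall x, f x != 0) -> ccontinuous f -> ccontinuous (fun x => (f x)^-1).
Proof.
move=> f0 [fr fi].
have n0 x : complex.Re (f x) ^+ 2 + complex.Im (f x) ^+ 2 != 0.
  have := f0 x; case: (f x) => a b; rewrite eq_complex /=.
  by rewrite paddr_eq0 ?sqr_ge0// !sqrf_eq0.
have nc : continuous
    (fun x => (complex.Re (f x) ^+ 2 + complex.Im (f x) ^+ 2)^-1).
  move=> x; apply: cvgV; first exact: n0.
  by apply: cvgD; [apply: cvgM; exact: fr | apply: cvgM; exact: fi].
split=> x.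
  rewrite (_ : (fun y => _) = fun y => complex.Re (f y) *
      (complex.Re (f y) ^+ 2 + complex.Im (f y) ^+ 2)^-1); last first.
    by apply/funext => y; case: (f y) => [? ?].
  by apply: cvgM; [exact: fr|exact: nc].
rewrite (_ : (fun y => _) = fun y => - (complex.Im (f y) *
    (complex.Re (f y) ^+ 2 + complex.Im (f y) ^+ 2)^-1)); last first.
  by apply/funext => y; case: (f y) => [? ?].
by apply: cvgN; apply: cvgM; [exact: fi|exact: nc].
Qed.

(** This is the principal square root on the right half-plane, by the half-angle formula: its real
    part [u] is positive there, so the division by [u] in the imaginary part is continuous. *)
Lemma ccontinuous_sqrt (T : topologicalType) (f : T -> C) :
  ccontinuous f -> (forall x, 0 < complex.Re (f x)) ->
  exists2 w : T -> C, ccontinuous w & forall x, f x = w x ^+ 2.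
Proof.
move=> [fr fi] fp.
pose n x := Num.sqrt (complex.Re (f x) ^+ 2 + complex.Im (f x) ^+ 2).
pose u x := Num.sqrt ((n x + complex.Re (f x)) / 2).
have cn : continuous n.
  move=> x; apply: (@continuous_comp _ _ _ (fun x => complex.Re (f x) ^+ 2 +
    complex.Im (f x) ^+ 2) Num.sqrt x); last exact: sqrt_continuous.
  by apply: cvgD; [apply: cvgM; exact: fr | apply: cvgM; exact: fi].
have cu : continuous u.
  move=> x; apply: (@continuous_comp _ _ _ (fun x => (n x + complex.Re (f x)) / 2)
    Num.sqrt x); last exact: sqrt_continuous.
  by apply: cvgM; [apply: cvgD; [exact: cn|exact: fr]|exact: cvg_cst].
have ss x : 0 < n x + complex.Re (f x).
  by apply: ltr_wpDl (fp x); rewrite sqrtr_ge0.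
have u2 x : u x ^+ 2 = (n x + complex.Re (f x)) / 2.
  by rewrite sqr_sqrtr// divr_ge0 ?ler0n// (ltW (ss x)).
have u0 x : u x != 0.
  by rewrite -sqrf_eq0 u2 mulf_neq0 ?invr_neq0 ?pnatr_eq0 ?lt0r_neq0.
have n2 x : n x ^+ 2 = complex.Re (f x) ^+ 2 + complex.Im (f x) ^+ 2.
  by rewrite sqr_sqrtr// addr_ge0 ?sqr_ge0.
exists (fun x => Complex (u x) (complex.Im (f x) / (2 * u x))).
  split=> x; first exact: cu.
  apply: cvgM; first exact: fi.
  apply: cvgV; first by rewrite mulf_neq0// pnatr_eq0.
  by apply: cvgM; [exact: cvg_cst|exact: cu].
move=> x; apply/eqP; rewrite eq_complex /=.
have := u0 x; have := u2 x; have := n2 x; have := ss x.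
move: (n x) (u x) => m v; case: (f x) => a b /= mp m2 v2 v0.
apply/andP; split; apply/eqP; last by field.
have -> : b / (2 * v) * (b / (2 * v)) = b ^+ 2 / (4 * v ^+ 2) by field.
rewrite -[v * v]expr2 v2 (_ : b ^+ 2 = m ^+ 2 - a ^+ 2); last by rewrite m2; ring.
by field; rewrite lt0r_neq0.
Qed.

(** If [f] has no zeros, then neither has [w]. On a finite graph, the classes of nonvanishing
    functions form the first integral cohomology group modulo 2. *)
Definition square_equiv (T : topologicalType) (f g : T -> C) : Prop :=
  exists2 w : T -> C, ccontinuous w & forall x, f x = g x * w x ^+ 2.

Lemma square_equiv_refl (T : topologicalType) (f : T -> C) : square_equiv f f.
Proof.
by exists (fun=> 1) => [|x]; [exact: ccontinuous_cst|rewrite expr1n mulr1].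
Qed.

Lemma square_equiv_sym (T : topologicalType) (f g : T -> C) :
  (forall x, f x != 0) -> square_equiv f g -> square_equiv g f.
Proof.
move=> f0 [w cw fE].
have w0 x : w x != 0.
  by apply: contraNneq (f0 x) => w0; rewrite fE w0 expr0n mulr0.
exists (fun x => (w x)^-1); first exact: ccontinuousV.
by move=> x; rewrite fE exprVn mulfK// expf_neq0.
Qed.

Lemma square_equiv_trans (T : topologicalType) (f g h : T -> C) :
  square_equiv f g -> square_equiv g h -> square_equiv f h.
Proof.
move=> [w cw fE] [v cv gE]; exists (fun x => v x * w x); first exact: ccontinuousM.
by move=> x; rewrite fE gE -mulrA exprMn.
Qed.

Lemma square_equiv_comp (T U : topologicalType) (h : T -> U) (f g : U -> C) :
  continuous h -> square_equiv f g -> square_equiv (f \o h) (g \o h).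
Proof.
by move=> ch [w cw fE]; exists (w \o h) => [|x /=]; [exact: ccontinuous_comp|].
Qed.

(** The parameters whose slice is equivalent to the slice at [t] form a nonempty clopen subset of
    the line, which is connected. Both openness and closedness come from the local statement
    [loc]. *)
Lemma square_equiv_homotopy (X : topologicalType) (F : X * R -> C) (s t : R) :
  compact [set: X] -> ccontinuous F -> (forall z, F z != 0) ->
  square_equiv (fun x => F (x, s)) (fun x => F (x, t)).
Proof.
move=> cX cF F0.
have cFt t0 : ccontinuous (fun x => F (x, t0)).
  apply: (@ccontinuous_comp _ _ (fun x => (x, t0)) F) => //.
  by apply: continuous_pair => x; [exact: cvg_id|exact: cvg_cst].
have loc t0 : \forall t' \near t0,
    square_equiv (fun x => F (x, t')) (fun x => F (x, t0)).
  (* The ratio to the slice at [t0] is 1 at time [t0]. By compactness of X its real part stays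
     positive on all of X for nearby times, so it has a continuous square root. *)
  pose q (z : X * R) := F z / F (z.1, t0).
  have cq : ccontinuous q.
    apply: ccontinuousM => //; apply: (@ccontinuousV _ (fun z => F (z.1, t0))) => //.
    by apply: (@ccontinuous_comp _ _ fst (fun x => F (x, t0))) => // z; exact: cvg_fst.
  have : \forall t' \near t0, [set: X] `<=`
      [set x | 0 < complex.Re (q (x, t'))].
    move/compact_near_coveringP: cX.
    move=> /(_ R (nbhs t0) (fun t' x => 0 < complex.Re (q (x, t')))); apply => x _.
    have q0 : (0 : R) < complex.Re (q (x, t0)) by rewrite /q /= divff// ltr01.
    have := cvgr_gt _ (cq.1 (x, t0)) _ q0.
    case=> [[U V] [Ux Vt] UV]; exists (U, V) => //= -[x' t'] /= [Ux' Vt'].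
    exact: (UV (x', t')).
  apply: filterS => t' qp.
  have [w cw qE] : exists2 w : X -> C, ccontinuous w &
      forall x, q (x, t') = w x ^+ 2.
    apply: ccontinuous_sqrt => [|x]; last exact: qp.
    apply: (@ccontinuous_comp _ _ (fun x => (x, t')) q) => //.
    by apply: continuous_pair => x; [exact: cvg_id|exact: cvg_cst].
  by exists w => // x; rewrite -qE mulrC divfK.
pose A := [set r | square_equiv (fun x => F (x, r)) (fun x => F (x, t))].
suff AT : A = setT by have : A s by rewrite AT.
have cR : connected [set: R] by apply/connected_intervalP => x y _ _ z _.
apply: cR.
- by exists t; exact: square_equiv_refl.
- exists A; last by rewrite setTI.
  rewrite openE => r Ar; have := loc r; apply: filterS => r' rr'.
  exact: square_equiv_trans rr' Ar.
- exists A; last by rewrite setTI.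
  rewrite -[A]setCK; apply: open_closedC; rewrite openE => r Ar.
  have := loc r; apply: filterS => r' rr' Ar'; apply: Ar.
  apply: square_equiv_trans Ar'.
  exact: square_equiv_sym rr'.
Qed.
End SquareClasses.

(** * Homotopy invariance of square classes, and continuity tools *)

Section Topology.
Variable R : realType.
Local Notation C := R[i].

(** A homotopy is only controlled over [0, 1]. Composing with this retraction of the line makes it
    continuous on all of [X * R]. *)
Definition clamp (t : R) : R := Num.max 0 (Num.min t 1).

Lemma clamp_continuous : continuous clamp.
Proof.
apply: (@max_fun_continuous _ R R (fun=> 0) (fun t => Num.min t 1)).
  by move=> t; exact: cvg_cst.
apply: (@min_fun_continuous _ R R id (fun=> 1)) => t; first exact: cvg_id.
exact: cvg_cst.
Qed.

Lemma clamp_ge0 t : 0 <= clamp t.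
Proof. by rewrite le_max lexx. Qed.

Lemma clamp_le1 t : clamp t <= 1.
Proof. by rewrite ge_max ler01 ge_min lexx orbT. Qed.

Lemma clamp_id t : t \in `[0, 1] -> clamp t = t.
Proof.
rewrite in_itv /= => /andP[t0 t1].
by rewrite /clamp min_l// max_r.
Qed.

Lemma homotopy_clamp (X Y : topologicalType) (f g : X -> Y) (H : X * R -> Y) :
  is_homotopy f g H -> continuous (fun z => H (z.1, clamp z.2)).
Proof.
move=> [/subspace_continuousP cH _ _] z.
have Hz : (setT `*` `[0, 1]%classic) (z.1, clamp z.2).
  by split=> //=; rewrite in_itv /= clamp_ge0 clamp_le1.
have cc : continuous (fun z : X * R => (z.1, clamp z.2)).
  apply: continuous_pair => x; first exact: cvg_fst.
  by apply: (@continuous_comp _ _ _ snd clamp); [exact: cvg_snd|exact: clamp_continuous].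
move=> U /(cH _ Hz); rewrite /nbhs /= /within /= => /cc; rewrite /nbhs /=.
apply: filterS => y; apply.
by split=> //=; rewrite in_itv /= clamp_ge0 clamp_le1.
Qed.

Lemma homotopic_square_equiv (X Y : topologicalType) (f g : X -> Y)
    (phi : Y -> C) :
  compact [set: X] -> ccontinuous phi -> (forall y, phi y != 0) ->
  homotopic R f g -> square_equiv (phi \o f) (phi \o g).
Proof.
move=> cX cphi phi0 [H hH]; have [_ H0 H1] := hH.
have := @square_equiv_homotopy R X (phi \o (fun z => H (z.1, clamp z.2))) 0 1 cX.
rewrite /= !clamp_id ?in_itv /= ?lexx ?ler01//.
rewrite (_ : (fun x => phi (H (x, 0))) = phi \o f); last first.
  by apply/funext => x /=; rewrite H0.
rewrite (_ : (fun x => phi (H (x, 1))) = phi \o g); last first.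
  by apply/funext => x /=; rewrite H1.
apply=> [|z]; last exact: phi0.
exact: (ccontinuous_comp (homotopy_clamp hH)).
Qed.

(** The chain is [phi], [phi \o g \o f], [psi \o g \o f], [psi]. Hence pulling back along [g] is
    injective on square classes, and X has no more of them than Y. *)
Lemma homotopy_retract_square_equiv (X Y : topologicalType) (f : X -> Y)
    (g : Y -> X) (phi psi : X -> C) :
  compact [set: X] -> continuous f -> homotopic R (g \o f) id ->
  ccontinuous phi -> (forall x, phi x != 0) ->
  ccontinuous psi -> (forall x, psi x != 0) ->
  square_equiv (phi \o g) (psi \o g) -> square_equiv phi psi.
Proof.
move=> cX cf gf cphi phi0 cpsi psi0 /(square_equiv_comp cf) e.
have e1 := homotopic_square_equiv cX cphi phi0 gf.
have e2 := homotopic_square_equiv cX cpsi psi0 gf.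
apply: square_equiv_trans (square_equiv_trans e e2).
by apply: square_equiv_sym e1 => x; exact: phi0.
Qed.

Lemma nonvanishing_same_sign (f : R -> R) : continuous f ->
  (forall t, t \in `[0, 1] -> f t != 0) -> 0 < f 0 * f 1.
Proof.
move=> cf f0; rewrite ltNge; apply/negP => f01.
have [||c c01 fc] := @IVT R f 0 1 0 ler01.
- exact: continuous_subspaceT.
- by rewrite ge_min le_max; case: (lerP (f 0) 0) f01 => /=; case: (lerP (f 1) 0) => //=; nra.
- by have := f0 c c01; rewrite fc eqxx.
Qed.

(** Pasting lemma: a neighbourhood of [x] avoids every closed piece that misses [x], and on the
    finitely many other pieces the functions [g i] agree with [f] at [x]. *)
Lemma closed_cover_continuous (T : topologicalType) (I : finType)
    (A : I -> set T) (f : T -> R) (g : I -> T -> R) :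
  (forall i, closed (A i)) -> (forall x, exists i, A i x) ->
  (forall i, continuous (g i)) -> (forall i x, A i x -> f x = g i x) ->
  continuous f.
Proof.
move=> Acl Acov gc fg x U fxU.
have : \forall y \near x, forall i : I, A i y -> U (g i y).
  apply: filter_forall => i; have [Ax|nAx] := pselect (A i x).
    have gU : nbhs (g i x) U by rewrite -(fg _ _ Ax).
    have := gc i x _ gU; rewrite /nbhs /=.
    by apply: filterS => y Uy _; exact: Uy.
  have : nbhs x (~` A i) by apply: open_nbhs_nbhs; split=> //; exact: closed_openC.
  by apply: filterS => y nAy /nAy.
apply: filterS => y Uy; have [i Ay] := Acov y.
by rewrite /= (fg _ _ Ay); exact: Uy.
Qed.

End Topology.

(** * Continuity in barycentric coordinates *)

Section RealizationContinuity.
Variables (R : realType) (gT : finGroupType) (G : {group gT}) (D : GComplex G).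

Lemma continuous_realization (T : topologicalType) (f : T -> realization R D) :
  (forall v, continuous (fun x => val (f x) v : R)) -> continuous f.
Proof.
move=> cf; apply: continuous_comp_initial => x.
apply/cvg_sup => v A [_ [[W oW <-] Wx sWA]].
have : nbhs (val (f x) v : R) W by apply: open_nbhs_nbhs.
move/(cf v x) => h; rewrite nbhs_simpl /=.
by apply: (@filterS _ (nbhs x) _ _ _ _ h) => y; exact: sWA.
Qed.

Lemma realization_coord_continuous v :
  continuous (fun x : realization R D => val x v : R).
Proof.
move=> x.
have cv : continuous (fun y : realization R D => val y : {ptws ambient D -> R}).
  exact: initial_continuous.
exact: (@continuous_comp _ _ _ _ (fun y : {ptws ambient D -> R} => y v) x (cv x)
  (@proj_continuous _ (fun=> R) v _)).
Qed.

End RealizationContinuity.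

(** * Fixed cosets of a strongly embedded subgroup *)

Section StronglyEmbedded.
Local Open Scope group_scope.
Variables (gT : finGroupType) (G S : {group gT}) (p : nat).
Hypotheses (p_pr : prime p) (strS : strongly_embedded p G S).

Lemma rcoset_fix (P : {group gT}) (x : gT) :
  (S :* x \in 'Fix_('Rs)(P)) = (P \subset S :^ x).
Proof.
apply/afixP/fintype.subsetP => [fixP g gP|sPS g gP].
  have : x * g \in S :* x.
    by rewrite -(fixP g gP) /= rcosetE -rcosetM rcoset_refl.
  by rewrite mem_rcoset mem_conjg /conjg invgK mulgA.
rewrite /= rcosetE -rcosetM; apply/rcoset_eqP; rewrite mem_rcoset.
by have := sPS g gP; rewrite mem_conjg /conjg invgK mulgA.
Qed.

(** Conjugating P by the inverse of [x] puts it inside S and inside the conjugate of S by the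
    inverse of [x * y^-1]. Unless [x * y^-1] lies in S, this intersection has order prime to p,
    which a nontrivial p-group forbids. *)
Lemma pgroup_fixed_coset_inj (P : {group gT}) x y : p.-group P -> P :!=: 1 ->
  P \subset S :^ x -> P \subset S :^ y -> x \in G -> y \in G ->
  S :* x = S :* y.
Proof.
move=> pP P1 sPx sPy xG yG; have [_ _ sE] := strS.
apply/rcoset_eqP; rewrite mem_rcoset; apply/negPn/negP => xyS.
have /negP := sE _ (groupM xG (groupVr yG)) xyS; apply.
have [_ pdP _] := pgroup_pdiv pP P1.
have dP : P :^ x^-1 \subset S :&: S :^ (x * y^-1)^-1.
  rewrite finset.subsetI !sub_conjg invgK sPx /=.
  by rewrite -conjsgM invMg invgK mulgKV.
apply: dvdn_trans pdP _.
by rewrite -(cardJg _ x^-1); exact: cardSg.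
Qed.

Lemma pgroup_fixed_coset (P : {group gT}) : p.-group P -> P :!=: 1 ->
  P \subset G ->
  exists2 c, c \in rcosets S G &
    forall d, d \in rcosets S G -> (d \in 'Fix_('Rs)(P)) = (d == c).
Proof.
have [/fintype.properP[sSG _] pS _] := strS.
have actsG (Q : {group gT}) : Q \subset G -> [acts Q, on rcosets S G | 'Rs].
  move=> sQG; apply/fintype.subsetP => g gQ; rewrite !inE /=.
  apply/fintype.subsetP => _ /rcosetsP[x xG ->]; rewrite inE /= rcosetE -rcosetM.
  by apply/rcosetsP; exists (x * g); rewrite ?groupM// (fintype.subsetP sQG).
have SC : S :* 1 \in rcosets S G by apply/rcosetsP; exists 1.
(* A Sylow p-subgroup of S is nontrivial and fixes the coset S only, so the index of S is 1 modulo
   p. Hence every p-subgroup of G fixes some coset. *)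
have pC : #|rcosets S G| = 1 %[mod p].
  have [Q sylQ] := Sylow_exists p S.
  have [sQS pQ _] := and3P sylQ.
  have Q1 : Q :!=: 1.
    rewrite trivg_card1 (card_Hall sylQ) p_part -(expn0 p) eqn_exp2l ?prime_gt1//.
    by rewrite -lt0n logn_gt0 mem_primes p_pr cardG_gt0.
  rewrite (pgroup_fix_mod pQ (actsG Q (fintype.subset_trans sQS sSG))).
  rewrite (_ : 'Fix_(_ | _)(Q) = [set S :* 1]%SET) ?cards1//.
  apply/finset.setP => c; rewrite finset.in_set1; apply/finset.setIP/eqP => [[]|->].
    move=> /rcosetsP[x xG ->]; rewrite rcoset_fix => sQx.
    by apply: (pgroup_fixed_coset_inj pQ) => //; rewrite conjsg1.
  by split=> //; rewrite rcoset_fix conjsg1.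
move=> pP P1 sPG.
have := pgroup_fix_mod pP (actsG P sPG); rewrite pC.
have [->|[c]] := finset.set_0Vmem ('Fix_(rcosets S G | 'Rs)(P)).
  by rewrite finset.cards0 mod0n modn_small// prime_gt1.
move=> /finset.setIP[cC cfix] _; exists c => // d dC.
apply/idP/eqP => [dfix|->//].
case/rcosetsP: cC cfix => x xG ->; case/rcosetsP: dC dfix => y yG ->.
rewrite !rcoset_fix => sPy sPx.
exact: (pgroup_fixed_coset_inj pP).
Qed.
End StronglyEmbedded.

(** * The join of the cosets with a trivial G-set *)

Section JoinComplex.
Variables (gT : finGroupType) (G S : {group gT}) (k : nat).
Local Notation T := ({set gT} + 'I_k.+1)%type.
Local Notation C := (rcosets S G).

(** The ambient type contains every subset of the group, on which ['Rs] acts by right translation.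
    The restriction to cosets of S in G is made later, by [join_vertex]. *)
Definition join_act_fun (v : T) (g : gT) : T :=
  if v is inl c then inl ('Rs%act c g) else v.

Lemma join_act_is_action : is_action G join_act_fun.
Proof.
split=> [g [c|i] [d|j] //= [/act_inj->//]|[c|i] g h gG hG //=].
by rewrite actM.
Qed.

Definition join_act : action G T := Action join_act_is_action.

Definition is_coset_side (v : T) : bool := if v is inl _ then true else false.

Definition join_vertex (v : T) : bool := if v is inl c then c \in C else true.

Definition join_simplices : {set {set T}} :=
  finset.finset (fun s : {set T} => [&& s != finset.set0,
    [forall v in s, join_vertex v] &
    [forall u in s, forall v in s,
      (is_coset_side u == is_coset_side v) ==> (u == v)]]).

Lemma join_simplexP (s : {set T}) :
  reflect [/\ s != finset.set0, forall v, v \in s -> join_vertex v &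
              {in s &, injective is_coset_side}] (s \in join_simplices).
Proof.
rewrite inE; apply: (iffP and3P) => -[s0 sV sI]; split=> //.
- by move=> v vs; exact: (forall_inP sV).
- move=> u v us vs /eqP uv; apply/eqP.
  by move: (forall_inP (forall_inP sI u us) v vs); rewrite uv.
- by apply/forall_inP.
- apply/forall_inP => u us; apply/forall_inP => v vs; apply/implyP => /eqP uv.
  by apply/eqP; exact: sI.
Qed.

Lemma join_simplex_neq0 s : s \in join_simplices -> s != finset.set0.
Proof. by case/join_simplexP. Qed.

Lemma join_simplex_face (s t : {set T}) :
  s \in join_simplices -> t \subset s -> t != finset.set0 ->
  t \in join_simplices.
Proof.
case/join_simplexP => _ sV sI /fintype.subsetP ts t0; apply/join_simplexP; split=> //.
  by move=> v /ts; exact: sV.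
by move=> u v /ts us /ts vs; exact: sI.
Qed.

Lemma join_act_vertex v g : g \in G -> join_vertex v -> join_vertex (join_act v g).
Proof.
case: v => //= c gG /rcosetsP[x xG ->]; rewrite rcosetE -rcosetM.
by apply/rcosetsP; exists (x * g)%g; rewrite ?groupM.
Qed.

Lemma join_act_side v g : is_coset_side (join_act v g) = is_coset_side v.
Proof. by case: v. Qed.

Lemma join_simplex_act g s :
  g \in G -> s \in join_simplices -> (join_act^*)%act s g \in join_simplices.
Proof.
move=> gG /join_simplexP[s0 sV sI]; apply/join_simplexP; split.
- by rewrite -finset.card_gt0 card_setact finset.card_gt0.
- by move=> _ /imsetP[v vs ->]; apply: join_act_vertex => //; exact: sV.
- move=> _ _ /imsetP[u us ->] /imsetP[v vs ->]; rewrite !join_act_side => uv.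
  by rewrite (sI u v).
Qed.

(** The action preserves the two sides and a simplex has at most one vertex on each, so an element
    stabilizing a simplex cannot permute its vertices. *)
Lemma join_simplex_stab s :
  s \in join_simplices -> ('N_G(s | join_act) \subset 'C_G(s | join_act))%g.
Proof.
case/join_simplexP => _ _ sI; apply/fintype.subsetP => g /finset.setIP[gG gs].
apply/finset.setIP; split=> //; rewrite !inE gG.
apply/fintype.subsetP => v vs; rewrite inE; apply/eqP; apply: sI => //.
  by rewrite (astabs_act _ gs).
exact: join_act_side.
Qed.

Definition join_complex : GComplex G :=
  MkGComplex join_simplex_neq0 join_simplex_face join_simplex_act
    join_simplex_stab.

Lemma mem_rcosets1 : (S : {set gT}) \in C.
Proof. by apply/rcosetsP; exists 1%g; rewrite ?rcoset1. Qed.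

Lemma join_complex_dim : has_dim 1 join_complex.
Proof.
split=> [|s /join_simplexP[_ _ sI]].
  exists [set inl (S : {set gT}); inr ord0]%SET; last by rewrite finset.cards2.
  apply/join_simplexP; split.
  - by apply/finset.set0Pn; exists (inr ord0); rewrite !inE eqxx orbT.
  - by move=> v /finset.set2P[] -> //=; exact: mem_rcosets1.
  - by move=> u v /finset.set2P[] -> /finset.set2P[] ->.
by rewrite -(card_in_imset sI) -card_bool max_card.
Qed.

(** * Barycentric coordinates on the join and the contraction onto a coset *)

Section Points.
Variable R : realType.

Lemma join_realizationP (x : T -> R) :
  realization_set (D := join_complex) x <->
  [/\ forall v, 0 <= x v, \sum_v x v = 1 &
      exists2 c, c \in C & exists i, forall v, v != inl c -> v != inr i -> x v = 0].
Proof.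
split=> [[x0 x1 /join_simplexP[_ sV sI]]|[x0 x1 [c cC [i xz]]]]; split=> //.
  have [c [cC cP]] : exists c, c \in C /\ forall d, x (inl d) != 0 -> d = c.
    have [[d dx]|nd] := pselect (exists d, x (inl d) != 0).
      exists d; split; first by apply: (sV (inl d)); rewrite inE.
      by move=> e ex; have [] : inl e = inl d :> T by apply: sI; rewrite ?inE.
    (* Without mass on any coset, the point is an apex and lies on an edge to every coset; S is the
       default. Likewise [ord0] below when no apex carries mass. *)
    exists (S : {set gT}); split; first exact: mem_rcosets1.
    by move=> d dx; case: nd; exists d.
  have [i iP] : exists i, forall j, x (inr j) != 0 -> j = i.
    have [[j jx]|nj] := pselect (exists j, x (inr j) != 0).
      exists j => e ex; have [] : inr e = inr j :> T by apply: sI; rewrite ?inE.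
      by [].
    by exists ord0 => j jx; case: nj; exists j.
  exists c => //; exists i => v vc vi; apply/eqP/negPn/negP.
  case: v vc vi => [d dc _ /cP dE|j _ ji /iP jE].
    by rewrite dE eqxx in dc.
  by rewrite jE eqxx in ji.
have sE v : x v != 0 -> v = inl c \/ v = inr i.
  have [->|vc] := eqVneq v (inl c); first by left.
  have [->|vi] := eqVneq v (inr i); first by right.
  by rewrite xz// eqxx.
apply/join_simplexP; split.
- apply/negP => /eqP s0; have : (\sum_v x v) != 0 by rewrite x1 oner_neq0.
  rewrite big1 ?eqxx// => v _; apply/eqP/negPn/negP => vx.
  by have := finset.in_set0 v; rewrite -s0 inE vx.
- by move=> v; rewrite inE => /sE[] ->.
- by move=> u v; rewrite !inE => /sE[] -> /sE[] ->.
Qed.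

Lemma fixed_realizationP (P : {group gT}) (sPG : P \subset G) (x : T -> R) :
  realization_set (D := fixed_complex join_complex sPG) x <->
  realization_set (D := join_complex) x /\
  forall v, x v != 0 -> v \in ('Fix_join_act(P))%g.
Proof.
split=> [[x0 x1]|[[x0 x1 xs] xf]].
  rewrite inE => /andP[xs /fintype.subsetP xf]; split=> // v vx.
  by apply: xf; rewrite inE.
split=> //; rewrite inE xs; apply/fintype.subsetP => v; rewrite inE.
exact: xf.
Qed.

Definition collapse (c : {set gT}) (x : T -> R) (v : T) : R :=
  if v is inl d then if d == c then \sum_e x (inl e) else 0 else x v.

(** At [t = 0] this is the retraction [collapse] onto the star of [c], which is the identity only on
    that star; as [t] grows to 1 the star shrinks linearly to its centre. Being defined on every
    point, the formula serves for fixed points, for orbits and for edges. *)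
Definition contract_to (c : {set gT}) (t : R) (x : T -> R) (v : T) : R :=
  (1 - t) * collapse c x v + t * (v == inl c)%:R.

Lemma sum_collapse c x : \sum_v collapse c x v = \sum_v x v.
Proof.
rewrite !big_sumType /=; congr (_ + _).
by rewrite -big_mkcond big_pred1_eq.
Qed.

Lemma contract_to_realization c t x : c \in C -> 0 <= t -> t <= 1 ->
  realization_set (D := join_complex) x ->
  realization_set (D := join_complex) (contract_to c t x).
Proof.
move=> cC t0 t1 /join_realizationP[x0 x1 [d dC [i xz]]].
apply/join_realizationP; split.
- move=> v; apply: addr_ge0; apply: mulr_ge0; rewrite ?subr_ge0//.
  by case: v => //= e; case: ifP => // _; exact: sumr_ge0.
- rewrite big_split -!mulr_sumr sum_collapse x1 (bigD1 (inl c)) //= eqxx.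
  by rewrite big1 => [|v /negbTE ->//]; rewrite addr0 !mulr1 subrK.
- exists c => //; exists i => v vc vi.
  rewrite /contract_to (negbTE vc) mulr0 addr0.
  case: v vc vi => [e ec _|j _ ji] /=.
    by rewrite ifN ?mulr0//; apply: contraNneq ec => ->.
  by rewrite xz ?mulr0.
Qed.

Lemma contract_to_fixed c (P : {group gT}) t x :
  c \in ('Fix_('Rs)(P))%g ->
  (forall v, x v != 0 -> v \in ('Fix_join_act(P))%g) ->
  forall v, contract_to c t x v != 0 -> v \in ('Fix_join_act(P))%g.
Proof.
move=> /afixP cf xf [d|i] h; last by apply/afixP.
apply/afixP => g gP /=; congr inl.
have [->|dc] := eqVneq d c; first exact: cf.
move: h; rewrite /contract_to /= (negbTE dc) mulr0 add0r.
rewrite (_ : (inl d == inl c :> T) = false) ?mulr0 ?eqxx//.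
by apply/negP => /eqP[] /eqP; rewrite (negbTE dc).
Qed.

End Points.
End JoinComplex.

(** * The contraction as a continuous map on the realization *)

Section JoinBuilding.
Variables (R : realType) (gT : finGroupType) (G S : {group gT}) (k : nat).
Local Notation T := ({set gT} + 'I_k.+1)%type.
Local Notation C := (rcosets S G).
Local Notation D := (join_complex G S k).

Lemma contract_to_continuous (U : topologicalType) (c : {set gT})
    (f : U -> T -> R) (g : U -> R) :
  (forall v, continuous (fun u => f u v)) -> continuous g ->
  forall v, continuous (fun u => contract_to c (g u) (f u) v).
Proof.
move=> cf cg v u; apply: cvgD; apply: cvgM.
- by apply: cvgB; [exact: cvg_cst|exact: cg].
- case: v => [d|i] /=; last exact: cf.
  case: ifP => _; last exact: cvg_cst.
  by apply: cvg_big => // [|e _]; [exact: add_continuous|exact: cf].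
- exact: cg.
- exact: cvg_cst.
Qed.

Lemma contract_to0 c x : (forall d, d != c -> x (inl d) = 0 :> R) ->
  contract_to c 0 x = x :> (T -> R).
Proof.
move=> xc; apply/funext => v; rewrite /contract_to subr0 mul1r mul0r addr0.
case: v => //= d; case: eqVneq => [->|/xc//].
by rewrite (bigD1 c) //= big1 ?addr0// => e /xc.
Qed.

Lemma contract_to1 c (x : T -> R) : contract_to c 1 x = (fun v => (v == inl c)%:R).
Proof. by apply/funext => v; rewrite /contract_to subrr mul0r add0r mul1r. Qed.

Lemma contract_to_act c g t (x : T -> R) : 'Rs%act c g = c ->
  contract_to c t (fun v => x (join_act G k v g)) =
  fun v => contract_to c t x (join_act G k v g).
Proof.
move=> cg; apply/funext => -[d|i]; last by [].
have cE e : ('Rs%act e g == c) = (e == c).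
  by rewrite -{1}cg (inj_eq (act_inj _ _)).
have lE e f : (inl e == inl f :> T) = (e == f) by [].
rewrite /contract_to /= !lE cE; congr (_ * _ + _); case: ifP => // _.
by rewrite [RHS](reindex_inj (act_inj 'Rs%act g)).
Qed.

Lemma join_contraction_subproof c (cC : c \in C) (t : R)
    (x : realization R D) :
  realization_set (D := D) (contract_to c (clamp t) (val x)).
Proof.
by apply: contract_to_realization => //;
  [exact: clamp_ge0|exact: clamp_le1|exact: set_valP].
Qed.

Definition join_contraction c (cC : c \in C) (z : realization R D * R) :
    realization R D :=
  exist _ (contract_to c (clamp z.2) (val z.1))
    (mem_set (join_contraction_subproof cC z.2 z.1)).

Lemma join_contraction_continuous c (cC : c \in C) :
  continuous (join_contraction cC).
Proof.
apply: continuous_realization => v.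
apply: (@contract_to_continuous (realization R D * R)%type c
  (fun z => val z.1 : T -> R) (fun z => clamp z.2)).
  move=> u z; apply: (@continuous_comp _ _ _ fst (fun x : realization R D => val x u)).
    exact: cvg_fst.
  exact: realization_coord_continuous.
move=> z; apply: (@continuous_comp _ _ _ snd (@clamp R)); first exact: cvg_snd.
exact: clamp_continuous.
Qed.

End JoinBuilding.

(** * Contractibility of the orbit space *)

Section JoinSlender.
Variables (R : realType) (gT : finGroupType) (G S : {group gT}) (k : nat).
Local Notation T := ({set gT} + 'I_k.+1)%type.
Local Notation C := (rcosets S G).
Local Notation D := (join_complex G S k).

Lemma vertex_realization (v : T) : join_vertex G S v ->
  realization_set (D := D) (fun u => (u == v)%:R : R).
Proof.
move=> vV; apply/join_realizationP; split=> [u||].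
- by rewrite ler0n.
- by rewrite (bigD1 v) //= eqxx big1 ?addr0// => u /negbTE ->.
case: v vV => [c cC|i _].
  by exists c => //; exists ord0 => v /negbTE ->.
by exists (S : {set gT}); [exact: mem_rcosets1|exists i => v _ /negbTE ->].
Qed.

Definition vertex_point (v : T) (vV : join_vertex G S v) : realization R D :=
  exist _ (fun u => (u == v)%:R) (mem_set (vertex_realization vV)).

Lemma join_contraction1 c (cC : c \in C) x :
  join_contraction cC (x, 1) = @vertex_point (inl c) cC.
Proof.
by apply/val_inj; rewrite /= clamp_id ?in_itv /= ?lexx ?ler01// contract_to1.
Qed.

(* Sliding all the mass on coset vertices to the coset S moves each point
   within its orbit, so that the star of S is a fundamental domain. *)
Lemma same_orbit_contraction (x : realization R D) :
  same_orbit x (join_contraction (mem_rcosets1 G S) (x, 0)).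
Proof.
have [x0 x1 [c /rcosetsP[y yG cE] [i xz]]] :=
  (join_realizationP G S (val x)).1 (set_valP x).
apply/existsP; exists (subg G y^-1%g); apply/eqP/val_inj/funext => v /=.
rewrite clamp_id ?in_itv /= ?lexx ?ler01// /contract_to subr0 mul1r mul0r addr0.
rewrite /coord_act subgK ?groupV// invgK.
case: v => // d /=; rewrite rcosetE.
case: eqVneq => [->|dS].
  rewrite -cE (bigD1 c) //= big1 ?addr0// => e ec.
  by apply: xz => //; apply: contraNneq ec => -[->].
apply: xz => //; apply: contraNneq dS => -[dE].
by rewrite -(rcosetK y d) dE cE rcosetK.
Qed.

(** The image depends only on the total mass on the coset side and on the apex coordinates, and all
    of these are invariant under G. *)
Lemma join_contraction_orbit (x y : realization R D) : same_orbit x y ->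
  join_contraction (mem_rcosets1 G S) (x, 0) =
  join_contraction (mem_rcosets1 G S) (y, 0).
Proof.
case/existsP => g /eqP <-; apply/val_inj/funext => v /=.
rewrite /contract_to; congr (_ * _ + _).
case: v => // d /=; case: ifP => // _.
by rewrite [LHS](reindex_inj (act_inj 'Rs%act (sgval g)^-1%g)).
Qed.

Lemma join_complex_slender : slender R D.
Proof.
set h := join_contraction (R := R) (k := k) (mem_rcosets1 G S).
have hc : continuous h by exact: join_contraction_continuous.
pose Q := orbit_space R D.
pose pi (x : realization R D) : Q := \pi_{eq_quot (orbit_rel R D)}%qT x.
have pi_eq x y : same_orbit x y -> pi x = pi y.
  by move=> xy; apply/eqmodP.
have piP (x y : realization R D) : pi x = pi y -> same_orbit x y.
  by move=> /eqmodP.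
(* The retraction onto the star of S is constant on orbits, so it descends to a continuous section
   of the orbit map. The contraction of the star is then pushed back down by [pi]. *)
pose rho (q : Q) := h (repr (q : {eq_quot (orbit_rel R D)}%qT), 0).
have rhoc : continuous rho.
  apply: (@repr_comp_continuous _ _ _ (fun x => h (x, 0))).
    move=> x; apply: (@continuous_comp _ _ _ (fun x => (x, 0 : R)) h); last exact: hc.
    by apply: continuous_pair => y; [exact: cvg_id|exact: cst_continuous].
  move=> x y /eqP xy; apply/eqP; apply: join_contraction_orbit.
  exact: piP.
exists (pi (@vertex_point (inl (S : {set gT})) (mem_rcosets1 G S))).
exists (fun z => pi (h (rho z.1, z.2))); split.
- apply: continuous_subspaceT => z.
  apply: (@continuous_comp _ _ _ (fun z : Q * R => h (rho z.1, z.2)) pi).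
    apply: (@continuous_comp _ _ _ (fun z : Q * R => (rho z.1, z.2)) h); last exact: hc.
    apply: continuous_pair => y; last exact: cvg_snd.
    by apply: (@continuous_comp _ _ _ fst rho); [exact: cvg_fst|exact: rhoc].
  exact: pi_continuous.
(* At time 0 the retraction has been applied twice, and each application stays in the orbit. *)
- move=> q; rewrite -[RHS](reprK q); apply: pi_eq.
  rewrite (same_orbit_sym (R := R)); apply: (same_orbit_trans (R := R)) (same_orbit_contraction _).
  exact: same_orbit_contraction.
- by move=> q; rewrite /= /h join_contraction1.
Qed.

End JoinSlender.

(** * The two conditions of a synthetic building *)

Section JoinSynthetic.
Variables (R : realType) (gT : finGroupType) (G S : {group gT}) (p k : nat).
Hypotheses (p_pr : prime p) (strS : strongly_embedded p G S).
Local Notation T := ({set gT} + 'I_k.+1)%type.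
Local Notation C := (rcosets S G).
Local Notation D := (join_complex G S k).

Lemma join_simplex_stab_dvd s : s \in simplices D ->
  (p %| #|('N_G(s | vact D))%g|)%N.
Proof.
move=> /[dup] sD /join_simplexP[_ sV sI].
have [/fintype.properP[sSG _] pS _] := strS.
(* The simplex has at most one coset vertex, say the coset of [x]; the conjugate of S by [x] then
   fixes the whole simplex. If there is no coset vertex, [x = 1] will do. *)
have [x xG sx] : exists2 x, x \in G & forall c, inl c \in s -> c = (S :* x)%g.
  have [[c cs]|nc] := pselect (exists c, inl c \in s).
    have /rcosetsP[x xG cE] : c \in C := sV _ cs.
    exists x => // d ds; rewrite -cE.
    by have [] : inl d = inl c :> T by apply: sI.
  by exists 1%g => // c cs; case: nc; exists c.
rewrite -(cardJg S x) in pS; apply: dvdn_trans pS _; apply: cardSg.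
have sSxG : (S :^ x)%g \subset G by rewrite -(conjGid xG) conjSg.
apply: (fintype.subset_trans _ (finset.setIS _ (astab_sub _ _))).
apply/fintype.subsetP => g gS; have gG := fintype.subsetP sSxG g gS.
rewrite !inE gG /=; apply/fintype.subsetP => -[c|i] vs; rewrite inE //=.
have : (S :* x)%g \in ('Fix_('Rs)((S :^ x)%G))%g by rewrite rcoset_fix.
by rewrite (sx c vs) => /afixP /(_ g gS) ->.
Qed.

(** The fixed points of P form the star of the unique fixed coset [c]. The normalizer of P fixes
    [c], so the linear contraction to [c] is equivariant. *)
Lemma fixed_complex_contractible (P : {group gT}) (sPG : P \subset G) :
  (p.-group P)%g -> P :!=: 1%g ->
  equivariantly_contractible R (point_act R (fixed_complex D sPG)).
Proof.
move=> pP P1.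
have [c cC cfix] := pgroup_fixed_coset p_pr strS pP P1 sPG.
have cP : c \in ('Fix_('Rs)(P))%g by rewrite cfix.
(* The normalizer permutes the cosets fixed by P, and there is only one. *)
have cN g : g \in ('N_G(P))%g -> 'Rs%act c g = c.
  move=> /finset.setIP[gG gN]; apply/eqP; rewrite -cfix; last first.
    case/rcosetsP: cC => x xG ->; rewrite /= rcosetE -rcosetM.
    by apply/rcosetsP; exists (x * g)%g; rewrite ?groupM.
  apply/afixP => a aP; rewrite -actM (conjgCV g a) actM.
  by rewrite (afixP cP)// memJ_norm ?groupV.
have hP t (x : realization R (fixed_complex D sPG)) :
    realization_set (D := fixed_complex D sPG) (contract_to c (clamp t) (val x)).
  have [xD xf] := (fixed_realizationP S sPG (val x)).1 (set_valP x).
  apply/fixed_realizationP; split; last exact: contract_to_fixed.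
  by apply: contract_to_realization => //; [exact: clamp_ge0|exact: clamp_le1].
pose h (z : realization R (fixed_complex D sPG) * R) :
    realization R (fixed_complex D sPG) := 
    exist _ (contract_to c (clamp z.2) (val z.1)) (mem_set (hP z.2 z.1)).
have vP : realization_set (D := fixed_complex D sPG) (fun u : T => (u == inl c)%:R : R).
  apply/fixed_realizationP; split; first exact: (@vertex_realization R _ G S k (inl c)).
  move=> v; rewrite pnatr_eq0 eqb0 negbK => /eqP ->.
  by apply/afixP => g gP /=; rewrite (afixP cP).
exists (exist _ (fun u : T => (u == inl c)%:R) (mem_set vP)), h; split; first split.
- apply: continuous_subspaceT; apply: continuous_realization => v.
  apply: (@contract_to_continuous _ _ _ (realization R (fixed_complex D sPG) * R)%type c
    (fun z => val z.1 : T -> R) (fun z => clamp z.2)).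
    move=> u z; apply: (@continuous_comp _ _ _ fst
      (fun x : realization R (fixed_complex D sPG) => val x u)).
      exact: cvg_fst.
    exact: realization_coord_continuous.
  move=> z; apply: (@continuous_comp _ _ _ snd (@clamp R)); first exact: cvg_snd.
  exact: clamp_continuous.
- move=> x; apply/val_inj; rewrite /= clamp_id ?in_itv /= ?lexx ?ler01//.
  apply: contract_to0 => d dc; apply/eqP/negPn/negP => xd.
  have [/join_realizationP[_ _ [e eC [i xz]]] xf] :=
    (fixed_realizationP S sPG (val x)).1 (set_valP x).
  have de : d = e.
    apply/eqP/negPn/negP => de; move/eqP: xd; apply; exact: xz.
  move: dc; rewrite -cfix ?de// => /negP; apply; rewrite -de.
  apply/afixP => g gP; have /afixP/(_ g gP) := xf _ xd.
  by case.
- by move=> x; apply/val_inj; rewrite /= clamp_id ?in_itv /= ?lexx ?ler01// contract_to1.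
- move=> g; apply/val_inj/funext => v /=; rewrite /coord_act /=.
  have gN := cN _ (groupVr (subgP g)).
  congr (nat_of_bool _)%:R; case: v => [d|i] //=.
  have lE e f : (inl e == inl f :> T) = (e == f) by [].
  by rewrite /ract /= !lE -{1}gN (inj_eq (act_inj _ _)).
- move=> g x t _; apply/val_inj => /=.
  exact: (@contract_to_act R _ G k c _ (clamp t) (val x) (cN _ (groupVr (subgP g)))).
Qed.

Lemma join_complex_synthetic : synthetic_building R p D.
Proof.
by split; [exact: fixed_complex_contractible|exact: join_simplex_stab_dvd].
Qed.

End JoinSynthetic.

(** * Square classes on the join *)

Section JoinSquareClasses.
Variables (R : realType) (gT : finGroupType) (G S : {group gT}) (k : nat).
Local Notation T := ({set gT} + 'I_k.+1)%type.
Local Notation C := (rcosets S G).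
Local Notation D := (join_complex G S k).
Local Notation X := (realization R D).

Definition apex (i : 'I_k.+1) : X :=
  @vertex_point R gT G S k (inr i) isT.

Definition coset_point c (cC : c \in C) : X :=
  @vertex_point R gT G S k (inl c) cC.

Lemma join_contraction_id c (cC : c \in C) (x : X) :
  (forall d, d != c -> val x (inl d) = 0) -> join_contraction cC (x, 0) = x.
Proof.
move=> xc; apply/val_inj; rewrite /= clamp_id ?in_itv /= ?lexx ?ler01//.
exact: contract_to0.
Qed.

(** This runs from the apex at 0 to the coset at 1; on [0, 1] the parameter is the mass at the
    coset. *)
Definition edge c (cC : c \in C) (i : 'I_k.+1) (t : R) : X :=
  join_contraction cC (apex i, t).

Lemma edge_continuous c (cC : c \in C) i : continuous (edge cC i).
Proof.
move=> t; apply: (@continuous_comp _ _ _ (fun t => (apex i, t)) (join_contraction cC)).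
  by apply: continuous_pair => y; [exact: cst_continuous|exact: cvg_id].
exact: join_contraction_continuous.
Qed.

Lemma edge0 c (cC : c \in C) i : edge cC i 0 = apex i.
Proof. by apply: join_contraction_id. Qed.

Lemma edge1 c (cC : c \in C) i : edge cC i 1 = coset_point cC.
Proof. exact: join_contraction1. Qed.

Lemma edge_inl c (cC : c \in C) i t d :
  val (edge cC i t) (inl d) = clamp t * (d == c)%:R.
Proof.
have lE : (inl d == inl c :> T) = (d == c) by [].
by rewrite /= /contract_to lE /= big1 // if_same mulr0 add0r.
Qed.

Lemma edge_inr c (cC : c \in C) i t j :
  val (edge cC i t) (inr j) = (1 - clamp t) * (j == i)%:R.
Proof. by rewrite /= /contract_to /= mulr0 addr0. Qed.

Lemma mem_edge (x : X) : exists c (cC : c \in C) i, exists2 t,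
  t \in `[0, 1] & x = edge cC i t.
Proof.
have [x0 x1 [c cC [i xz]]] := (join_realizationP G S (val x)).1 (set_valP x).
have xi : val x (inr i) = 1 - val x (inl c).
  rewrite -x1 (bigD1 (inl c)) //= (bigD1 (inr i)) //= big1 ?addr0 1?addrC ?addrK//.
  by move=> v /andP[]; exact: xz.
have t01 : val x (inl c) \in `[0, 1].
  by rewrite in_itv /= x0 -subr_ge0 -xi x0.
exists c, cC, i, (val x (inl c)) => //.
apply/val_inj/funext => -[d|j]; rewrite ?edge_inl ?edge_inr clamp_id//.
  have [->|dc] := eqVneq d c; first by rewrite mulr1.
  by rewrite mulr0; exact: xz.
rewrite -xi; have [->|ji] := eqVneq j i; first by rewrite mulr1.
by rewrite mulr0; exact: xz.
Qed.

Lemma realization_compact : compact [set: X].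
Proof.
pose F (e : {c | c \in C} * 'I_k.+1) := edge (valP e.1) e.2 @` `[0, 1]%classic.
have -> : [set: X] = \big[setU/set0]_(e <- enum {: {c | c \in C} * 'I_k.+1}) F e.
  rewrite -bigcup_seq; apply/seteqP; split=> // x _.
  have [c [cC [i [t t01 ->]]]] := mem_edge x.
  exists (exist _ c cC, i); first by rewrite /= mem_enum.
  exists t => //=; congr edge; exact: bool_irrelevance.
apply: bigsetU_compact => e _; apply: continuous_compact.
  by apply: continuous_subspaceT; exact: edge_continuous.
exact: segment_compact.
Qed.

(** The star of [c] is contractible: composed with the retraction onto it, [psi] is homotopic to the
    constant [psi (coset_point cC)], which has a complex square root. *)
Lemma coset_sqrt (psi : X -> R[i]) c (cC : c \in C) :
  ccontinuous psi -> (forall x, psi x != 0) ->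
  exists2 w : X -> R[i], ccontinuous w &
    forall x, psi (join_contraction cC (x, 0)) = w x ^+ 2.
Proof.
move=> cpsi psi0.
have := @square_equiv_homotopy R X (psi \o join_contraction cC) 0 1
  realization_compact.
case=> [||w cw wE].
- by apply: ccontinuous_comp => //; exact: join_contraction_continuous.
- by move=> z; exact: psi0.
exists (fun x => sqrtC (psi (coset_point cC)) * w x).
  by apply: ccontinuousM => //; exact: ccontinuous_cst.
by move=> x; rewrite [LHS]wE /= join_contraction1 exprMn sqrtCK.
Qed.

(* The realization is the union of the stars of the cosets, on each of which a
   nonvanishing function has a square root w_c.  Two functions whose roots
   disagree by the same signs at the apices have a ratio with a square root. *)
Lemma square_class_signature :
  exists sig : (X -> R[i]) -> {ffun {set gT} * 'I_k.+1 -> bool},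
    forall phi psi : X -> R[i], ccontinuous phi -> (forall x, phi x != 0) ->
      ccontinuous psi -> (forall x, psi x != 0) ->
      sig phi = sig psi -> square_equiv phi psi.
Proof.
have [W WP] : exists W : (X -> R[i]) -> {set gT} -> X -> R[i], forall psi c,
    ccontinuous psi -> (forall x, psi x != 0) -> forall cC : c \in C,
    ccontinuous (W psi c) /\
    forall x, psi (join_contraction cC (x, 0)) = W psi c x ^+ 2.
  suff /choice[W WP] : forall psic : (X -> R[i]) * {set gT},
      exists w : X -> R[i],
      ccontinuous psic.1 -> (forall x, psic.1 x != 0) -> forall cC : psic.2 \in C,
      ccontinuous w /\ forall x, psic.1 (join_contraction cC (x, 0)) = w x ^+ 2.
    by exists (fun psi c => W (psi, c)) => psi c; exact: (WP (psi, c)).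
  move=> [psi c] /=.
  have [[[cpsi psi0] cC]|nh] :=
      pselect ((ccontinuous psi /\ forall x, psi x != 0) /\ c \in C); last first.
    by exists (fun=> 0) => cpsi psi0 cC; case: nh.
  have [w cw wE] := coset_sqrt cC cpsi psi0.
  by exists w => _ _ cC'; rewrite (bool_irrelevance cC' cC).
have SC := mem_rcosets1 G S.
exists (fun psi => [ffun ci => W psi ci.1 (apex ci.2) == W psi S (apex ci.2)]).
move=> phi psi cphi phi0 cpsi psi0 sigE.
have apexW f c (cC : c \in C) i : ccontinuous f -> (forall x, f x != 0) ->
    f (apex i) = W f c (apex i) ^+ 2.
  move=> cf f0; have [_ <-] := WP f c cf f0 cC.
  by rewrite -[join_contraction _ _]/(edge cC i 0) edge0.
have W0 f c (cC : c \in C) x : ccontinuous f -> (forall x, f x != 0) ->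
    W f c x != 0.
  move=> cf f0; have [_ /(_ x) fE] := WP f c cf f0 cC.
  by rewrite -sqrf_eq0 -fE.
pose V c x := W phi c x / W psi c x.
have Vc c (cC : c \in C) : ccontinuous (V c).
  apply: ccontinuousM; first exact: (WP phi c cphi phi0 cC).1.
  apply: (@ccontinuousV _ _ (W psi c)) => [x|]; first exact: W0.
  exact: (WP psi c cpsi psi0 cC).1.
(* At an apex, the roots for [c] and for S square to the same number, so they differ by a sign.
   Equal signatures mean equal signs for [phi] and [psi], and these cancel in the ratio. *)
have Vapex c (cC : c \in C) i : V c (apex i) = V S (apex i).
  have /ffunP/(_ (c, i)) := sigE; rewrite !ffunE /= => sE.
  have sgn f : ccontinuous f -> (forall x, f x != 0) ->
      W f c (apex i) = (if W f c (apex i) == W f S (apex i) then 1 else -1) *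
        W f S (apex i).
    move=> cf f0; case: eqVneq => [->|ne]; first by rewrite mul1r.
    have /eqP := apexW f c cC i cf f0.
    rewrite (apexW f S SC i cf f0) eq_sym eqf_sqr (negbTE ne) /= => /eqP ->.
    by rewrite mulN1r.
  rewrite /V (sgn phi)// (sgn psi)// sE; case: ifP => _; first by rewrite !mul1r.
  by rewrite !mulN1r invrN mulrNN.
(* This names the star containing [x]. The default S is taken exactly at points without coset mass,
   which are the apices. *)
pose side (x : X) : {set gT} := odflt (S : {set gT}) [pick c | val x (inl c) != 0].
have sideP (x : X) : side x \in C /\ forall d, d != side x -> val x (inl d) = 0.
  have [_ _ [c cC [i xz]]] := (join_realizationP G S (val x)).1 (set_valP x).
  rewrite /side; case: pickP => [e ex|nx] /=; last first.
    by split=> // d _; have /negbFE/eqP := nx d.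
  have <- : c = e.
    by apply/eqP/negPn/negP => ce; move/eqP: ex; apply; apply: xz; rewrite // eq_sym.
  by split=> // d dc; exact: xz.
pose A c := [set x : X | forall d, d != c -> val x (inl d) = 0].
have Acl c : closed (A c).
  rewrite (_ : A c = \bigcap_(d in [set d | d != c])
      ((fun x : X => val x (inl d)) @^-1` [set 0])); last first.
    by apply/seteqP; split=> x Ax d; exact: Ax.
  apply: closed_bigI => d _.
  by apply: preimage_closed => [x _|];
    [exact: realization_coord_continuous|exact: closed_eq].
(* Distinct stars meet only in apices, where the ratios agree by [Vapex]; so the ratios glue over
   the closed stars [A c]. *)
have VE (x : X) c (cC : c \in C) : A c x -> V (side x) x = V c x.
  move=> Ax; have [sC xs] := sideP x.
  have [->//|sc] := eqVneq (side x) c.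
  have xA : forall d, val x (inl d) = 0.
    by move=> d; have [->|/xs//] := eqVneq d (side x); exact: Ax.
  have [e [eC [i [t t01 xE]]]] := mem_edge x.
  have t0 : t = 0.
    by have := xA e; rewrite xE edge_inl eqxx mulr1 clamp_id.
  by rewrite xE t0 edge0 (Vapex c cC) (Vapex _ (sideP _).1).
exists (fun x => V (side x) x).
  have glue (proj : R[i] -> R) :
      (forall c, c \in C -> continuous (fun x => proj (V c x))) ->
      continuous (fun x => proj (V (side x) x)).
    move=> cV; apply: (@closed_cover_continuous R X {c | c \in C}
      (fun c => A (val c)) _ (fun c x => proj (V (val c) x))) => [c|x|c|c x Ax].
    - exact: Acl.
    - by have [sC xs] := sideP x; exists (exist _ (side x) sC).
    - exact: cV (valP c).
    - by rewrite (VE x (val c) (valP c)).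
  by split; apply: glue => c cC; [exact: (Vc _ cC).1|exact: (Vc _ cC).2].
move=> x; have [sC xs] := sideP x.
have [_ /(_ x)] := WP phi (side x) cphi phi0 sC.
have [_ /(_ x)] := WP psi (side x) cpsi psi0 sC.
rewrite join_contraction_id// => -> ->.
by rewrite /V expr_div_n mulrC divfK// expf_neq0// W0.
Qed.

End JoinSquareClasses.

(** * Functions with distinct square classes *)

Section JoinLowerBound.
Variables (R : realType) (gT : finGroupType) (G S : {group gT}) (k : nat).
Local Notation T := ({set gT} + 'I_k.+1)%type.
Local Notation C := (rcosets S G).
Local Notation D := (join_complex G S k).
Local Notation X := (realization R D).

(* The affine map to the plane sending the coset S to 1, the other cosets to
   -1, the apex i to 'i and the other apices to -'i: no edge meets 0. *)
Definition winding (i : 'I_k.+1) (x : X) : R[i] :=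
  Complex (2 * val x (inl (S : {set gT})) - \sum_d val x (inl d))
          (2 * val x (inr i) - \sum_j val x (inr j)).

Lemma winding_continuous i : ccontinuous (winding i).
Proof.
have cv v : continuous (fun x : X => val x v : R).
  exact: realization_coord_continuous.
have cs (I : finType) (h : I -> T) :
    continuous (fun x : X => \sum_d (val x (h d) : R)).
  exact: (continuous_big (@add_continuous R) (fun d _ => cv (h d))).
by split; apply: continuous_scalerB; [exact: cv|exact: cs|exact: cv|exact: cs].
Qed.

Lemma winding_edge i c (cC : c \in C) j t : winding i (edge cC j t) =
  Complex (if c == S then clamp t else - clamp t)
          (if j == i then 1 - clamp t else - (1 - clamp t)).
Proof.
have pt : \sum_d val (edge cC j t) (inl d) = clamp t.
  rewrite (bigD1 c) // edge_inl eqxx mulr1 big1 => [|d /andP[_ /negbTE dc]].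
    by rewrite /= addr0.
  by rewrite edge_inl dc mulr0.
have pj : \sum_l val (edge cC j t) (inr l) = 1 - clamp t.
  rewrite (bigD1 j) // edge_inr eqxx mulr1 big1 => [|d /andP[_ /negbTE dc]].
    by rewrite /= addr0.
  by rewrite edge_inr dc mulr0.
rewrite /winding pt pj edge_inl edge_inr [_ == c]eq_sym [i == j]eq_sym.
by congr Complex; case: eqVneq => _ /=; ring.
Qed.

Lemma winding_neq0 i x : winding i x != 0.
Proof.
have [c [cC [j [t _ ->]]]] := mem_edge x; rewrite winding_edge eq_complex /=.
apply/negP => /andP[/eqP h1 /eqP h2].
have : clamp t = 0 by case: ifP h1 => _; lra.
by case: ifP h2 => _; lra.
Qed.

(** With z = a + bi and w = u + vi, the hypothesis says that z is its conjugate times the square of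
    w. So w times the conjugate of z squares to the norm a^2 + b^2 > 0; it is therefore real and
    nonzero, and its real part is ua + vb. *)
Lemma complex_square_neq0 (a b u v : R) :
  (a != 0) || (b != 0) ->
  Complex a b = Complex a (- b) * Complex u v ^+ 2 -> u * a + v * b != 0.
Proof.
move=> ab [h1 h2]; apply/negP => /eqP h0.
have : a ^+ 2 + b ^+ 2 <= 0.
  rewrite (_ : a ^+ 2 + b ^+ 2 = (u * a + v * b) ^+ 2 - (v * a - u * b) ^+ 2).
    by rewrite h0 expr0n sub0r oppr_le0 sqr_ge0.
  by rewrite [a ^+ 2]expr2 [b ^+ 2]expr2 {2}h1 {2}h2; ring.
rewrite le_eqVlt ltNge addr_ge0 ?sqr_ge0// orbF paddr_eq0 ?sqr_ge0//.
by rewrite !sqrf_eq0 => /andP[a0 b0]; rewrite a0 b0 in ab.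
Qed.

(* Along the loop S, apex i, c, apex 0 through another coset c, the first
   function winds once around 0 and the second one does not. *)
Lemma winding_not_square_equiv i j : S \proper G ->
  i != ord0 -> j != ord0 -> i != j -> ~ square_equiv (winding i) (winding j).
Proof.
move=> /fintype.properP[sSG [y yG yS]] i0 j0 ij [w [cu cv] wE].
have SC := mem_rcosets1 G S.
have cC : (S :* y)%g \in C by apply/rcosetsP; exists y.
have cS : ((S :* y)%g == S) = false.
  by apply/negP => /eqP cS; move/negP: yS; apply; rewrite -cS rcoset_refl.
move: (S :* y)%g cC cS => c cC cS.
pose u x := complex.Re (w x); pose v x := complex.Im (w x).
have wuv x : w x = Complex (u x) (v x) by rewrite /u /v; case: (w x).
have ce d (dC : d \in C) l : continuous (fun t => u (edge dC l t)).
  move=> t; apply: (@continuous_comp _ _ _ (edge (R := R) dC l) u).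
    exact: edge_continuous.
  exact: cu.
have cf d (dC : d \in C) l : continuous (fun t => v (edge dC l t)).
  move=> t; apply: (@continuous_comp _ _ _ (edge (R := R) dC l) v).
    exact: edge_continuous.
  exact: cv.
(* On edges at apex 0 the two functions coincide, so [w] squares to 1 there and its real part keeps
   its sign. *)
have u0 d (dC : d \in C) : 0 < u (apex R G S ord0) * u (coset_point R k dC).
  rewrite -(edge0 R dC ord0) -(edge1 R dC ord0).
  apply: (@nonvanishing_same_sign R (fun t => u (edge dC ord0 t))) => // t _.
  have wij : winding i (edge dC ord0 t) = winding j (edge dC ord0 t).
    by rewrite !winding_edge ![ord0 == _]eq_sym (negbTE i0) (negbTE j0).
  have [h1 _] : Complex (u (edge dC ord0 t)) (v (edge dC ord0 t)) ^+ 2 = 1.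
    by apply: (mulfI (winding_neq0 j (edge dC ord0 t))); rewrite mulr1 -wuv -wE.
  by apply/negP => /eqP ut; move: h1; rewrite ut; nra.
(* On edges at apex [i] the two functions are complex conjugate. By [complex_square_neq0] the
   quantity [f] keeps its sign from the apex, where it is [v], to the coset, where it is [u] up to
   [sgn]. *)
have ui d (dC : d \in C) : 0 < v (apex R G S i) *
    (u (coset_point R k dC) * (if d == S then 1 else -1)).
  pose sgn : R := if d == S then 1 else -1.
  pose f t := u (edge dC i t) * (clamp t * sgn) + v (edge dC i t) * (1 - clamp t).
  have f0 : f 0 = v (apex R G S i).
    by rewrite /f edge0 clamp_id ?in_itv /= ?lexx ?ler01//; ring.
  have f1 : f 1 = u (coset_point R k dC) * sgn.
    by rewrite /f edge1 clamp_id ?in_itv /= ?lexx ?ler01//; ring.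
  rewrite -/sgn -f0 -f1; apply: nonvanishing_same_sign => [t|t _].
    apply: cvgD; apply: cvgM.
    - exact: ce.
    - by apply: cvgM; [exact: clamp_continuous|exact: cvg_cst].
    - exact: cf.
    - by apply: cvgB; [exact: cvg_cst|exact: clamp_continuous].
  have := wE (edge dC i t); rewrite !winding_edge eqxx (negbTE ij) wuv.
  have -> : (if d == S then clamp t else - clamp t) = clamp t * sgn.
    by rewrite /sgn; case: ifP => _; ring.
  move/complex_square_neq0; apply.
  rewrite mulf_eq0 (_ : (sgn == 0) = false) ?orbF; last first.
    by rewrite /sgn; case: ifP => _; rewrite ?oppr_eq0 oner_eq0.
  by case: eqVneq => // -> /=; rewrite subr0 oner_eq0.
(* Through apex 0, [u] has the same sign at S and at [c]. Through apex [i], the signs are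
   opposite. *)
have := u0 _ SC; have := u0 _ cC; have := ui _ SC; have := ui _ cC.
rewrite eqxx cS; nra.
Qed.

End JoinLowerBound.

(** * Comparing homotopy types by counting square classes *)

Section JoinInequivalent.
Variables (R : realType) (gT : finGroupType) (G S : {group gT}).
Hypothesis sSG : S \proper G.

(** This counts the possible signatures, hence bounds the number of square classes on the join with
    [k.+1] apices. *)
Definition class_bound (k : nat) : nat :=
  #|{: {ffun {set gT} * 'I_k.+1 -> bool}}|.

Lemma join_retract_bound k l (f : realization R (join_complex G S l) ->
    realization R (join_complex G S k)) g :
  continuous f -> continuous g -> homotopic R (g \o f) id ->
  (l <= class_bound k)%N.
Proof.
move=> cf cg gf; have [sig sigP] := square_class_signature R G S k.
(* [lift ord0] runs over the [l] apices other than apex 0, which is reserved as the common return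
   point of the loops. *)
pose s (i : 'I_l) := sig (winding (lift ord0 i) \o g).
have si : injective s.
  move=> i j sij; apply/eqP/negPn/negP => ij.
  have lij : lift ord0 i != lift ord0 j by rewrite (inj_eq (@lift_inj _ _)).
  apply: (winding_not_square_equiv (R := R) sSG _ _ lij); rewrite 1?eq_sym ?neq_lift//.
  apply: (homotopy_retract_square_equiv (@realization_compact R gT G S l) cf gf);
    do ?exact: winding_continuous; do ?exact: winding_neq0.
  apply: sigP => //; do ?[by move=> x; exact: winding_neq0];
    by apply: ccontinuous_comp => //; exact: winding_continuous.
by have := leq_card s si; rewrite card_ord.
Qed.

End JoinInequivalent.

Theorem theorem6p17 (R : realType) (gT : finGroupType) (G : {group gT})
    (p : nat) (p_prime : prime p)
    (strG : exists S : {group gT}, strongly_embedded p G S) :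
  exists D : nat -> GComplex G,
    (forall n, [/\ has_dim 1 (D n), slender R (D n)
                 & synthetic_building R p (D n)]) /\
    (forall m n, m <> n ->
       ~ homotopy_equivalent R (realization R (D m)) (realization R (D n))).
Proof.
have [S strS] := strG; have [sSG _ _] := strS.
(* Each value exceeds both its predecessor and the class bound of its predecessor, hence the class
   bounds of all earlier values. *)
pose step k := (k + class_bound gT k).+1.
pose bnd n := iter n step 0%N.
have bndP m n : (m < n)%N -> (class_bound gT (bnd m) < bnd n)%N.
  move=> mn; apply: (@leq_trans (bnd m.+1)).
    by rewrite /bnd iterS ltnS leq_addl.
  rewrite -(subnK mn); elim: (n - m.+1)%N => // d /leq_trans; apply.
  by rewrite addSn [leqRHS]/bnd iterS -/(bnd _) leqW// leq_addr.
exists (fun n => join_complex G S (bnd n)); split=> [n|m n mn].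
  split; [exact: join_complex_dim|exact: join_complex_slender|].
  exact: join_complex_synthetic.
move=> [f [g [cf cg gf fg]]].
(* In either case the larger graph would be a homotopy retract of the smaller one, which has too few
   square classes. *)
have [lt_mn|lt_nm|//] := ltngtP m n.
  by have := join_retract_bound sSG cg cf fg; rewrite leqNgt bndP.
by have := join_retract_bound sSG cf cg gf; rewrite leqNgt bndP.
Qed.
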